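(* Let $\epsilon,\kappa,\sigma>0$, $0<\theta<\theta_c$, $0<\delta<1$, and let $u^0\in\mathcal{M}_h$ have all its values in $(-1,1)$. The P-ETDRK2 scheme conserves mass unconditionally: for any time step size $\tau>0$, any sequence $(u^n)_{n\ge 0}$ in $\mathcal{M}_h$ generated by the P-ETDRK2 scheme from $u^0$ satisfies $$\langle u^{n+1},1\rangle=\langle u^n,1\rangle\qquad\text{for all } n\ge 0.$$
   Context: **Grid functions.** Let $\Omega=(0,L)\times(0,L)$, let $M$ be a positive integer, $h=L/M$, and let $\mathcal{M}_h$ be the space of real grid functions $v=(v_{ij})$ on the mesh points $(x_i,y_j)=(ih,jh)$, $1\le i,j\le M$, extended $M$-periodically in each index. Set $\langle v,w\rangle=h^2\sum_{i,j=1}^M v_{ij}w_{ij}$, $\|v\|_\infty=\max_{i,j}|v_{ij}|$ and $\overline{v}=L^{-2}\langle v,1\rangle$. The discrete Laplacian is $\Delta_h v_{ij}=h^{-2}(v_{i+1,j}+v_{i-1,j}+v_{i,j-1}+v_{i,j+1}-4v_{ij})$. Linear operators on $\mathcal{M}_h$ are identified with matrices, and functions of a symmetric operator are understood spectrally. Products, powers and inequalities of grid functions are pointwise. **Operators.** $L_h=\epsilon^2\Delta_h^2-\kappa\Delta_h+\sigma I$ (symmetric positive definite), and for $v\in\mathcal{M}_h$ with values in $(-1,1)$, $$F(v)=\tfrac{\theta}{2}\Delta_h[\ln(1+v)-\ln(1-v)]-\theta_c\Delta_h v-\kappa\Delta_h v+\sigma\overline{v}.$$ Let $\varphi_0(a)=e^{-a}$,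 $\varphi_1(a)=\frac{1-e^{-a}}{a}$, $\varphi_2(a)=\frac{e^{-a}-1+a}{a^2}$. **Projection step.** Given $\widetilde v\in\mathcal{M}_h$, its projection $v$ is the minimizer of $\frac12\langle\phi-\widetilde v,\phi-\widetilde v\rangle$ over all $\phi\in\mathcal{M}_h$ with $\|\phi\|_\infty\le1-\delta$ and $\langle\phi,1\rangle=\langle\widetilde v,1\rangle$. This is characterized by the Karush-Kuhn-Tucker system: with $g(u)=(1-\delta)^2-u^2$, there are $\lambda\in\mathcal{M}_h$ and $\xi\in\mathbb{R}$ such that $v=\widetilde v+\lambda g'(v)+\xi$, $\lambda g(v)=0$, $\lambda\ge0$, $g(v)\ge0$, $\langle v,1\rangle=\langle\widetilde v,1\rangle$. **P-ETDRK2 scheme.** Given $u^n$: 1. $\widetilde u^{n+1}_{\rm mid}=\varphi_0(\tau L_h)u^n+\tau\varphi_1(\tau L_h)F(u^n)$, and $u^{n+1}_{\rm mid}$ is the projection of $\widetilde u^{n+1}_{\rm mid}$. 2. The prediction is $$\widetilde u^{n+1}=\varphi_0(\tau L_h)u^n+\tau\big[(\varphi_1(\tau L_h)-\varphi_2(\tau L_h))F(u^n)+\varphi_2(\tau L_h)F(u^{n+1}_{\rm mid})\big],$$ equivalently $\widetilde u^{n+1}=e^{-\tau L_h}u^n+\int_0^\tau e^{-(\tau-s)L_h}\big((1-\frac{s}{\tau})F(u^n)+\frac{s}{\tau}F(u^{n+1}_{\rm mid})\big)ds$, and $u^{n+1}$ is the projection of $\widetilde u^{n+1}$. *)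

(* Defs.v *)
From HB Require Import structures.
From mathcomp Require Import all_boot all_order all_algebra.
From mathcomp Require Import sesquilinear spectral.
From mathcomp Require Import complex.
From mathcomp Require Import all_classical all_reals all_analysis.
From mathcomp Require Import ring lra.

Set Implicit Arguments.
Unset Strict Implicit.
Unset Printing Implicit Defensive.

Import Order.TTheory GRing.Theory Num.Theory.
Import numFieldNormedType.Exports.
Local Open Scope classical_set_scope.
Local Open Scope ring_scope.

(* A grid function on the M x M mesh is a matrix v : 'M[R]_M; the indices run  *)
(* over residues mod M, so that the M-periodic neighbours i + 1 and i - 1 of  *)
(* i : 'I_M are ordS i and ord_pred i, and the constant grid function c is    *)
(* const_mx c. The norm `|v| is the maximum norm.                             *)
Definition mesh (R : realType) (M : nat) (L : R) : R := L / M%:R.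

Definition gdot (R : realType) (M : nat) (L : R) (v w : 'M[R]_M) : R :=
  mesh M L ^+ 2 * \sum_i \sum_j v i j * w i j.

Definition gmean (R : realType) (M : nat) (L : R) (v : 'M[R]_M) : R :=
  L ^- 2 * gdot L v (const_mx 1).

Definition glap (R : realType) (M : nat) (L : R) (v : 'M[R]_M) : 'M[R]_M :=
  \matrix_(i, j) (mesh M L ^- 2 *
    (v (ordS i) j + v (ord_pred i) j + v i (ord_pred j) + v i (ordS j)
     - 4 * v i j)).

Definition stabop (R : realType) (M : nat) (L epsilon kappa sigma : R)
    (v : 'M[R]_M) : 'M[R]_M :=
  epsilon ^+ 2 *: glap L (glap L v) - kappa *: glap L v + sigma *: v.

Definition nonlin (R : realType) (M : nat) (L theta theta_c kappa sigma : R)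
    (v : 'M[R]_M) : 'M[R]_M :=
  (theta / 2) *: glap L (\matrix_(i, j) (ln (1 + v i j) - ln (1 - v i j)))
  - theta_c *: glap L v - kappa *: glap L v + const_mx (sigma * gmean L v).

(* B = f(A), read off a real orthonormal eigenbasis of A (the rows of P). *)
Definition is_mxfun (R : realType) (n : nat) (f : R -> R) (A B : 'M[R]_n) :=
  exists (P : 'M[R]_n) (d : 'rV[R]_n),
    [/\ P *m P^T = 1%:M, A = P^T *m diag_mx d *m P
      & B = P^T *m diag_mx (map_mx f d) *m P].

(* The value of the relation above, which is functional and, on symmetric     *)
(* matrices, total: see is_mxfun_uniq and mxfunP.                             *)
Definition mxfun (R : realType) (n : nat) (f : R -> R) (A : 'M[R]_n) : 'M[R]_n :=
  xget 0 [set B | is_mxfun f A B].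

(* Functional calculus for a linear operator on grid functions, through its   *)
(* matrix in the canonical orthogonal basis (lin_mx acts on the right).       *)
Definition opfun (R : realType) (M : nat) (f : R -> R)
    (T : 'M[R]_M -> 'M[R]_M) (v : 'M[R]_M) : 'M[R]_M :=
  vec_mx (mxvec v *m mxfun f (lin_mx T)).

(* phi1 and phi2 are only ever evaluated at positive eigenvalues; their       *)
(* values at 0 are junk.                                                      *)
Definition phi0 (R : realType) (a : R) : R := expR (- a).
Definition phi1 (R : realType) (a : R) : R := (1 - expR (- a)) / a.
Definition phi2 (R : realType) (a : R) : R := (expR (- a) - 1 + a) / a ^+ 2.

Definition proj_admissible (R : realType) (M : nat) (L delta : R)
    (vt phi : 'M[R]_M) : Prop :=
  `|phi| <= 1 - delta /\
  gdot L phi (const_mx 1) = gdot L vt (const_mx 1).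

Definition is_projection (R : realType) (M : nat) (L delta : R)
    (vt v : 'M[R]_M) : Prop :=
  proj_admissible L delta vt v /\
  forall phi, proj_admissible L delta vt phi ->
    2^-1 * gdot L (v - vt) (v - vt) <= 2^-1 * gdot L (phi - vt) (phi - vt).

Definition etd_mid (R : realType) (M : nat)
    (L epsilon kappa sigma theta theta_c tau : R) (u : 'M[R]_M) : 'M[R]_M :=
  let tauL w := tau *: stabop L epsilon kappa sigma w in
  let F := nonlin L theta theta_c kappa sigma in
  opfun (@phi0 R) tauL u + tau *: opfun (@phi1 R) tauL (F u).

Definition etd_pred (R : realType) (M : nat)
    (L epsilon kappa sigma theta theta_c tau : R) (u umid : 'M[R]_M)
    : 'M[R]_M :=
  let tauL w := tau *: stabop L epsilon kappa sigma w in
  let F := nonlin L theta theta_c kappa sigma in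
  opfun (@phi0 R) tauL u
  + tau *: ((opfun (@phi1 R) tauL (F u) - opfun (@phi2 R) tauL (F u))
            + opfun (@phi2 R) tauL (F umid)).

Definition petdrk2_step (R : realType) (M : nat)
    (L epsilon kappa sigma theta theta_c delta tau : R) (u u' : 'M[R]_M)
    : Prop :=
  exists umid : 'M[R]_M,
    is_projection L delta
      (etd_mid L epsilon kappa sigma theta theta_c tau u) umid /\
    is_projection L delta
      (etd_pred L epsilon kappa sigma theta theta_c tau u umid) u'.

Definition petdrk2 (R : realType) (M : nat)
    (L epsilon kappa sigma theta theta_c delta tau : R) (u0 : 'M[R]_M)
    (u : nat -> 'M[R]_M) : Prop :=
  u 0%N = u0 /\
  forall n, petdrk2_step L epsilon kappa sigma theta theta_c delta tau
              (u n) (u n.+1).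

Lemma is_mxfun_uniq (R : realType) (n : nat) (f : R -> R) (A B B' : 'M[R]_n) :
  is_mxfun f A B -> is_mxfun f A B' -> B = B'.
Proof.
move=> [P [d [PP eA ->]]] [Q [e [QQ eA' ->]]].
have PP' := mulmx1C PP; have QQ' := mulmx1C QQ.
have intertwine (W : 'M[R]_n) : diag_mx d *m W = W *m diag_mx e ->
    diag_mx (map_mx f d) *m W = W *m diag_mx (map_mx f e).
  move=> dW; apply/matrixP => i j; move/matrixP/(_ i j): dW.
  rewrite !mul_diag_mx !mul_mx_diag !mxE => H.
  have [->|W0] := eqVneq (W i j) 0; first by rewrite mulr0 mul0r.
  by move: H; rewrite mulrC => /(mulfI W0) ->; exact: mulrC.
have {}/intertwine fW : diag_mx d *m (P *m Q^T) = P *m Q^T *m diag_mx e.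
  transitivity (P *m A *m Q^T); first by rewrite eA !mulmxA PP mul1mx.
  by rewrite eA' -!mulmxA QQ mulmx1.
transitivity (P^T *m (diag_mx (map_mx f d) *m (P *m Q^T)) *m Q).
  by rewrite -!mulmxA QQ' mulmx1.
by rewrite fW !mulmxA PP' mul1mx.
Qed.

Lemma sym_eigenvalue (R : realType) (n : nat) (A : 'M[R]_n.+1) :
  A^T = A -> exists a, eigenvalue A a.
Proof.
move=> symA; pose Ac := map_mx (real_complex R) A.
have hA : Ac \is hermsymmx.
  apply: realsym_hermsym.
    apply/is_hermitianmxP; rewrite expr0 scale1r /Ac.
    by rewrite map_mx_id // map_trmx symA.
  by apply/mxOverP => i j; rewrite mxE complex_real.
have := hermitian_spectral_diag_real hA => /mxOverP /(_ 0 0) dR.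
have /orthomx_spectralP eA := hermitian_normalmx hA.
have [a ea] : exists a, spectral_diag Ac 0 0 = a%:C%C.
  by exists (complex.Re (spectral_diag Ac 0 0)); rewrite RRe_real.
exists a; rewrite -(eigenvalue_map (real_complex R)) /= -/Ac -ea.
apply/eigenvalueP; exists (row 0 (spectralmx Ac)).
  rewrite {2}eA -!mulmxA -row_mul !mulmxA mulmxV ?spectral_unit // mul1mx.
  by apply/rowP => j; rewrite mul_diag_mx !mxE.
apply/negP => /eqP r0; have := spectral_unit Ac.
move/(congr1 (mulmx^~ (invmx (spectralmx Ac)))): r0.
rewrite mul0mx -row_mul => /[swap] /mulmxV -> /rowP /(_ 0).
by rewrite !mxE eqxx => /eqP; rewrite oner_eq0.
Qed.

Lemma dotv_gt0 (R : realType) (n : nat) (u : 'rV[R]_n) :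
  u != 0 -> 0 < (u *m u^T) 0 0.
Proof.
have -> : (u *m u^T) 0 0 = \sum_j u 0 j ^+ 2.
  by rewrite mxE; apply: eq_bigr => j _; rewrite mxE.
move=> u0; rewrite lt_neqAle eq_sym sumr_ge0 ?andbT => [|j _]; last exact: sqr_ge0.
apply: contraNneq u0 => /eqP; rewrite psumr_eq0 => [/allP z|j _]; last exact: sqr_ge0.
apply/eqP/rowP => j; rewrite mxE.
by have := z j (mem_index_enum j) => /=; rewrite sqrf_eq0 => /eqP.
Qed.

Lemma real_spectral (R : realType) (n : nat) (A : 'M[R]_n) :
  A^T = A -> exists (P : 'M[R]_n) (d : 'rV[R]_n),
    P *m P^T = 1%:M /\ A = P^T *m diag_mx d *m P.
Proof.
elim: n A => [|n IHn] A symA.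
  by exists 1%:M, 0; split; apply/matrixP; case.
have [a /eigenvalueP [u uA u0]] := sym_eigenvalue symA.
pose s : R := (u *m u^T) 0 0.
have s_gt0 : 0 < s by exact: dotv_gt0.
pose v := (Num.sqrt s)^-1 *: u.
have vA : v *m A = a *: v by rewrite -scalemxAl uA !scalerA mulrC.
have vv : v *m v^T = 1%:M.
  rewrite /v linearZ /= -scalemxAl -scalemxAr scalerA [u *m _]mx11_scalar -/s.
  rewrite scale_scalar_mx -expr2 exprVn sqr_sqrtr ?ltW // mulVf //.
  by rewrite gt_eqF.
pose e : 'rV[R]_n.+1 := delta_mx 0 0.
have ee : e *m e^T = 1%:M.
  rewrite /e trmx_delta mul_delta_mx.
  by apply/matrixP => i j; rewrite !ord1 !mxE !eqxx.
have [Q [QQ Qs eQ]] : exists Q : 'M[R]_n.+1, [/\ Q *m Q = 1%:M, Q^T = Q & e *m Q = v].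
  have [w wE] : exists w, w = e - v by exists (e - v).
  have [w0|w0] := eqVneq w 0.
    exists 1%:M; rewrite mulmx1 trmx1; split=> //; rewrite mulmx1.
    by apply/eqP; rewrite -subr_eq0 -wE w0.
  pose c : R := (e *m v^T) 0 0.
  have evE : e *m v^T = c%:M by rewrite [LHS]mx11_scalar.
  have veE : v *m e^T = c%:M.
    by rewrite -[LHS]trmxK trmx_mul trmxK evE tr_scalar_mx.
  have ewE : e *m w^T = (1 - c)%:M.
    by rewrite wE linearB /= mulmxBr ee evE raddfB.
  have wwE : w *m w^T = (2 * (1 - c))%:M.
    rewrite {1}wE mulmxBl ewE wE linearB /= mulmxBr veE vv -!raddfB /=.
    by congr (_ %:M); ring.
  have c1 : 1 - c != 0.
    apply/eqP => c0; have := dotv_gt0 w0.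
    by rewrite wwE c0 mulr0 mxE mul0rn ltxx.
  pose k := (1 - c)^-1.
  exists (1%:M - k *: (w^T *m w)); split.
  - rewrite mulmxBl mul1mx mulmxBr mulmx1 -scalemxAl -scalemxAr.
    rewrite -mulmxA (mulmxA w) wwE mul_scalar_mx -scalemxAr !scalerA.
    rewrite opprB -[X in X - _]addr0.
    have -> : k * (k * (2 * (1 - c))) = k + k by rewrite /k; field.
    by rewrite scalerDl addr0 addrK subrK.
  - by rewrite linearB /= trmx1 linearZ /= trmx_mul trmxK.
  - rewrite mulmxBr mulmx1 -scalemxAr mulmxA ewE mul_scalar_mx scalerA.
    by rewrite mulVf // scale1r wE opprB addrC subrK.
have [B defB] : exists B, B = Q *m A *m Q by exists (Q *m A *m Q).
have symB : B^T = B by rewrite defB !trmx_mul Qs symA mulmxA.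
have eB : e *m B = a *: e.
  by rewrite defB !mulmxA eQ vA -scalemxAl -eQ -mulmxA QQ mulmx1.
have B0 j : B 0 j = a * (j == 0)%:R.
  have := congr1 (fun M : 'rV_n.+1 => M 0 j) eB.
  by rewrite -rowE !mxE !eqxx.
pose B1 : 'M[R]_(1 + n) := B.
have BE : B1 = block_mx a%:M 0 0 (drsubmx B1).
  have lrz : (0 : 'I_(1 + n)) = lshift n 0 by apply: val_inj.
  have ur : ursubmx B1 = 0.
    apply/matrixP => i j; rewrite ord1 !mxE -lrz [LHS]B0.
    by rewrite [_ == _]negbTE ?mulr0.
  rewrite -[LHS]submxK ur; congr (block_mx _ _ _ _).
    by apply/matrixP => i j; rewrite !ord1 !mxE -lrz [LHS]B0 eqxx mulr1 mulr1n.
  by rewrite -[LHS]trmxK trmx_dlsub symB ur trmx0.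
have symD : (drsubmx B1)^T = drsubmx B1 by rewrite trmx_drsub symB.
have [P' [d' [PP' DE]]] := IHn _ symD.
pose P1 : 'M[R]_(1 + n) := block_mx 1%:M 0 0 P'.
have P1T : P1^T = block_mx 1%:M 0 0 P'^T by rewrite tr_block_mx !trmx0 trmx1.
have key : B1 = P1^T *m diag_mx (row_mx a%:M d') *m P1.
  rewrite [LHS]BE P1T diag_mx_row !mulmx_block.
  rewrite !(mulmx0, mul0mx, mulmx1, mul1mx, addr0, add0r) -DE.
  by congr block_mx; apply/matrixP => i j; rewrite !ord1 !mxE mulr1n.
exists ((P1 : 'M[R]_n.+1) *m Q), (row_mx a%:M d' : 'rV[R]_(1 + n)).
split.
  rewrite trmx_mul Qs -mulmxA (mulmxA Q) QQ mul1mx [_^T]P1T.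
  rewrite [LHS](@mulmx_block _ 1 n 1 n 1 n).
  by rewrite !(mulmx0, mul0mx, mulmx1, addr0, add0r) PP' -scalar_mx_block.
have AE : A = Q *m B *m Q by rewrite defB !mulmxA QQ mul1mx -mulmxA QQ mulmx1.
rewrite trmx_mul Qs [in LHS]AE -!mulmxA; congr (_ *m _); rewrite !mulmxA.
by congr (_ *m _); exact: key.
Qed.

Lemma mxfunP (R : realType) (n : nat) (f : R -> R) (A : 'M[R]_n) :
  A^T = A -> is_mxfun f A (mxfun f A).
Proof.
move=> symA; rewrite /mxfun; case: xgetP => [B _ //|H].
have [P [d [PP eA]]] := real_spectral symA.
by have := H (P^T *m diag_mx (map_mx f d) *m P); case; exists P, d.
Qed.

Lemma glap_is_linear (R : realType) (M : nat) (L : R) : linear (@glap R M L).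
Proof. by move=> a v w; apply/matrixP => i j; rewrite !mxE; ring. Qed.

HB.instance Definition _ (R : realType) (M : nat) (L : R) :=
  GRing.isLinear.Build R 'M[R]_M 'M[R]_M *:%R (@glap R M L)
    (@glap_is_linear R M L).

Lemma stabop_is_linear (R : realType) (M : nat) (L epsilon kappa sigma : R) :
  linear (@stabop R M L epsilon kappa sigma).
Proof.
move=> a v w; rewrite /stabop !linearP /=.
by apply/matrixP => i j; rewrite !mxE; ring.
Qed.

HB.instance Definition _ (R : realType) (M : nat) (L epsilon kappa sigma : R) :=
  GRing.isLinear.Build R 'M[R]_M 'M[R]_M *:%R (@stabop R M L epsilon kappa sigma)
    (@stabop_is_linear R M L epsilon kappa sigma).

Lemma glap_sym (R : realType) (M : nat) (L : R) (v w : 'M[R]_M) :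
  \sum_i \sum_j glap L v i j * w i j = \sum_i \sum_j v i j * glap L w i j.
Proof.
have shr (f g : 'I_M -> 'I_M -> R) :
    (\sum_i \sum_j f (ordS i) j * g i j = \sum_i \sum_j f i j * g (ord_pred i) j).
  rewrite [RHS](reindex_onto (@ordS M) (@ord_pred M)) => [|i _]; last exact: ord_predK.
  by apply: eq_big => [i|i _]; rewrite ?ordSK ?eqxx.
have shc (f g : 'I_M -> 'I_M -> R) :
    (\sum_i \sum_j f i (ordS j) * g i j = \sum_i \sum_j f i j * g i (ord_pred j)).
  apply: eq_bigr => k _.
  rewrite [RHS](reindex_onto (@ordS M) (@ord_pred M)) => [|i _]; last exact: ord_predK.
  by apply: eq_big => [i|i _]; rewrite ?ordSK ?eqxx.
pose c := mesh M L ^- 2.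
have ex (x y : 'M[R]_M) : \sum_i \sum_j glap L x i j * y i j =
   c * ((\sum_i \sum_j x (ordS i) j * y i j) +
        (\sum_i \sum_j x (ord_pred i) j * y i j) +
        (\sum_i \sum_j x i (ord_pred j) * y i j) +
        (\sum_i \sum_j x i (ordS j) * y i j) -
        4 * (\sum_i \sum_j x i j * y i j)).
  rewrite mulr_sumr -sumrN -!big_split /= mulr_sumr; apply: eq_bigr => i _.
  rewrite mulr_sumr -sumrN -!big_split /= mulr_sumr; apply: eq_bigr => j _.
  by rewrite mxE -/c; ring.
have sw (f g : 'I_M -> 'I_M -> R) :
    \sum_i \sum_j f i j * g i j = \sum_i \sum_j g i j * f i j.
  by apply: eq_bigr => i _; apply: eq_bigr => j _; exact: mulrC.
rewrite [RHS]sw !ex (shr v w) (shc v w) (shr w v) (shc w v).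
rewrite (sw (fun i j => v (ord_pred i) j)) (sw (fun i j => v i (ord_pred j))).
rewrite (sw (fun i j => w (ord_pred i) j)) (sw (fun i j => w i (ord_pred j))).
by rewrite (sw w v); ring.
Qed.

Lemma lin_mx_sym (R : realType) (M : nat) (T : {linear 'M[R]_M -> 'M[R]_M}) :
  (forall v w : 'M[R]_M, \sum_i \sum_j T v i j * w i j = \sum_i \sum_j v i j * T w i j) ->
  (lin_mx T)^T = lin_mx T.
Proof.
have mxvec_delta2 (v : 'M[R]_M) k l :
    \sum_i \sum_j v i j * (delta_mx k l : 'M[R]_M) i j = v k l.
  rewrite (bigD1 k) //= (bigD1 l) //= !mxE !eqxx mulr1 !big1 ?addr0 //.
    by move=> i /negbTE ik; rewrite big1 // => j _; rewrite mxE ik mulr0.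
  by move=> j /negbTE jl; rewrite mxE jl andbF mulr0.
move=> symT; apply/matrixP => a b; rewrite mxE.
case/mxvec_indexP: a => i j; case/mxvec_indexP: b => k l.
have E p q r s : lin_mx T (mxvec_index p q) (mxvec_index r s) =
    T (delta_mx p q) r s.
  have := congr1 (fun x : 'rV_(M * M) => x 0 (mxvec_index r s))
            (mul_vec_lin T (delta_mx p q)).
  by rewrite mxvec_delta -rowE mxvecE mxE.
rewrite !E -[LHS]mxvec_delta2 symT.
rewrite -[RHS]mxvec_delta2.
by apply: eq_bigr => x _; apply: eq_bigr => y _; exact: mulrC.
Qed.

Lemma stabop_sym (R : realType) (M : nat) (L epsilon kappa sigma tau : R) :
  (lin_mx (fun v : 'M[R]_M => tau *: stabop L epsilon kappa sigma v))^T =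
  lin_mx (fun v : 'M[R]_M => tau *: stabop L epsilon kappa sigma v).
Proof.
pose T := tau \*: (@stabop R M L epsilon kappa sigma : {linear _ -> _}).
rewrite [lin_mx _](_ : _ = lin_mx T) //; apply: lin_mx_sym => v w /=.
have E (x y : 'M[R]_M) : \sum_i \sum_j (tau *: stabop L epsilon kappa sigma x) i j * y i j =
    tau * (epsilon ^+ 2 * (\sum_i \sum_j glap L (glap L x) i j * y i j)
     - kappa * (\sum_i \sum_j glap L x i j * y i j)
     + sigma * (\sum_i \sum_j x i j * y i j)).
  rewrite !mulr_sumr -sumrN -!big_split /= mulr_sumr; apply: eq_bigr => i _.
  rewrite !mulr_sumr -sumrN -!big_split /= mulr_sumr; apply: eq_bigr => j _.
  rewrite /stabop; move: (glap L (glap L x)) (glap L x) => p q.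
  by rewrite !mxE; ring.
have sw (x y : 'M[R]_M) : \sum_i \sum_j x i j * y i j = \sum_i \sum_j y i j * x i j.
  by apply: eq_bigr => i _; apply: eq_bigr => j _; exact: mulrC.
rewrite [RHS]sw !E (glap_sym L (glap L v) w) (glap_sym L v (glap L w)) (glap_sym L v w).
by rewrite (sw (glap L (glap L w)) v) (sw (glap L w) v) (sw w v).
Qed.

(* Main.v *)
(* Against the constant grid function 1, the discrete Laplacian vanishes, so 1
   is an eigenvector of tau L_h with eigenvalue a = tau sigma, and
   <F(v), 1> = sigma <v, 1>.  Since tau L_h is symmetric, both predictions reduce
   to the scalar identity phi0 a + a phi1 a = 1, in which the two phi2 terms
   cancel because the projection already gives the midpoint the mass of u^n. *)
Require Import Defs.
From mathcomp Require Import all_boot all_order all_algebra.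
From mathcomp Require Import all_classical all_reals all_analysis.
From mathcomp Require Import ring.

Set Implicit Arguments.
Unset Strict Implicit.
Unset Printing Implicit Defensive.

Import Order.TTheory GRing.Theory Num.Theory.
Import numFieldNormedType.Exports.
Local Open Scope ring_scope.

(** In the eigenbasis [P] the hypothesis says [d_i y_i = a y_i] for [y = P *m x]. So each coordinate
    either vanishes or has [d_i = a], and replacing [d_i] by [f d_i] multiplies [y] by [f a]. *)
Lemma is_mxfun_eigenvector (R : realType) (n : nat) (f : R -> R)
    (A B : 'M[R]_n) (a : R) (x : 'cV[R]_n) :
  is_mxfun f A B -> A *m x = a *: x -> B *m x = f a *: x.
Proof.
move=> [P [d [PP -> ->]]] Ax; have PP' := mulmx1C PP.
have {Ax} dx : diag_mx d *m (P *m x) = a *: (P *m x).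
  by rewrite scalemxAr -Ax !mulmxA PP mul1mx.
suff fdx : diag_mx (map_mx f d) *m (P *m x) = f a *: (P *m x).
  by rewrite -!mulmxA fdx -scalemxAr mulmxA PP' mul1mx.
apply/matrixP => i j; move/matrixP/(_ i j): dx.
rewrite !mul_diag_mx !mxE => H; set y := \sum_k _ in H *.
have [->|y0] := eqVneq y 0; first by rewrite !mulr0.
by rewrite (mulIf y0 H).
Qed.

(** Flattening makes the inner product a matrix product, so that it composes with [opfun] and
    inherits bilinearity. *)
Lemma gdot_mxvec (R : realType) (M : nat) (L : R) (v w : 'M[R]_M) :
  gdot L v w = mesh M L ^+ 2 * (mxvec v *m (mxvec w)^T) 0 0.
Proof.
rewrite /gdot pair_bigA mxE (reindex _ (curry_mxvec_bij M M)) /=.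
by congr (_ * _); apply: eq_bigr => -[i j] _ /=; rewrite mxE !mxvecE.
Qed.

Lemma gdotDl (R : realType) (M : nat) (L : R) (v v' w : 'M[R]_M) :
  gdot L (v + v') w = gdot L v w + gdot L v' w.
Proof. by rewrite !gdot_mxvec linearD mulmxDl mxE mulrDr. Qed.

Lemma gdotZl (R : realType) (M : nat) (L c : R) (v w : 'M[R]_M) :
  gdot L (c *: v) w = c * gdot L v w.
Proof. by rewrite !gdot_mxvec linearZ -scalemxAl mxE mulrCA. Qed.

Lemma gdotBl (R : realType) (M : nat) (L : R) (v v' w : 'M[R]_M) :
  gdot L (v - v') w = gdot L v w - gdot L v' w.
Proof. by rewrite gdotDl -scaleN1r gdotZl mulN1r. Qed.

(** Associativity lets the matrix of [f(T)] act on the column of [w] instead of the row of [v]. *)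
Lemma gdot_opfun_eigenvector (R : realType) (M : nat) (L : R) (f : R -> R)
    (T : {linear 'M[R]_M -> 'M[R]_M}) (a : R) (v w : 'M[R]_M) :
  (lin_mx T)^T = lin_mx T -> T w = a *: w ->
  gdot L (opfun f T v) w = f a * gdot L v w.
Proof.
move=> symT Tw; rewrite !gdot_mxvec /opfun vec_mxK -mulmxA.
(* [lin_mx T] acts on rows from the right; its symmetry turns the row eigenvector [mxvec w] into a
   column eigenvector. *)
have /(is_mxfun_eigenvector (mxfunP f symT)) -> :
    lin_mx T *m (mxvec w)^T = a *: (mxvec w)^T.
  by rewrite -{1}symT -trmx_mul mul_vec_lin Tw linearZ linearZ.
by rewrite -scalemxAr mxE mulrCA.
Qed.

Lemma glap_const (R : realType) (M : nat) (L c : R) :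
  glap L (const_mx c : 'M[R]_M) = 0.
Proof. by apply/matrixP => i j; rewrite !mxE; ring. Qed.

(** Summation by parts on the periodic mesh moves the Laplacian onto the constant. *)
Lemma gdot_glap1 (R : realType) (M : nat) (L : R) (v : 'M[R]_M) :
  gdot L (glap L v) (const_mx 1) = 0.
Proof.
rewrite /gdot glap_sym glap_const big1 ?mulr0 // => i _.
by rewrite big1 // => j _; rewrite mxE mulr0.
Qed.

Lemma gdot_const1 (R : realType) (M : nat) (L c : R) :
  (0 < M)%N -> gdot L (const_mx c : 'M[R]_M) (const_mx 1) = c * L ^+ 2.
Proof.
move=> M_gt0; have M0 : M%:R != 0 :> R by rewrite pnatr_eq0 -lt0n.
rewrite /gdot (eq_bigr (fun=> M%:R * c)) => [|i _]; last first.
  rewrite (eq_bigr (fun=> c)) => [|j _]; last by rewrite !mxE mulr1.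
  by rewrite sumr_const card_ord mulr_natl.
by rewrite sumr_const card_ord -mulr_natl /mesh; field.
Qed.

(** The logarithmic term is itself a Laplacian and vanishes with the others. In the mean term, the
    factor [L ^- 2] cancels the area [L ^+ 2]. *)
Lemma gdot_nonlin1 (R : realType) (M : nat) (L theta theta_c kappa sigma : R)
    (v : 'M[R]_M) :
  (0 < M)%N -> L != 0 ->
  gdot L (nonlin L theta theta_c kappa sigma v) (const_mx 1) =
  sigma * gdot L v (const_mx 1).
Proof.
move=> M_gt0 L0; rewrite /nonlin gdotDl !gdotBl !gdotZl !gdot_glap1.
by rewrite gdot_const1 // /gmean; field.
Qed.

Lemma gdot_opfun_stabop1 (R : realType) (M : nat)
    (L epsilon kappa sigma tau : R) (f : R -> R) (v : 'M[R]_M) :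
  gdot L (opfun f (fun w => tau *: stabop L epsilon kappa sigma w) v)
    (const_mx 1) =
  f (tau * sigma) * gdot L v (const_mx 1).
Proof.
(* The same operator, bundled with its linear structure. *)
pose T := tau \*: (@stabop R M L epsilon kappa sigma : {linear _ -> _}).
apply: (@gdot_opfun_eigenvector R M L f T); first exact: stabop_sym.
rewrite /= /stabop glap_const (linear0 (@glap R M L)) !scaler0 subr0 add0r.
by rewrite scalerA.
Qed.

Lemma phi0D (R : realType) (a : R) : a != 0 -> phi0 a + a * phi1 a = 1.
Proof. by move=> a0; rewrite /phi0 /phi1; field. Qed.

Lemma gdot_etd_mid1 (R : realType) (M : nat)
    (L epsilon kappa sigma theta theta_c tau : R) (u : 'M[R]_M) :
  (0 < M)%N -> L != 0 -> tau * sigma != 0 ->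
  gdot L (etd_mid L epsilon kappa sigma theta theta_c tau u) (const_mx 1) =
  gdot L u (const_mx 1).
Proof.
move=> M_gt0 L0 a0; rewrite /etd_mid gdotDl gdotZl !gdot_opfun_stabop1.
(* The factor 1 put before the mass is expanded as [phi0 a + a * phi1 a] with [a = tau * sigma]. *)
by rewrite gdot_nonlin1 // -[RHS]mul1r -(phi0D a0); ring.
Qed.

Lemma gdot_etd_pred1 (R : realType) (M : nat)
    (L epsilon kappa sigma theta theta_c tau : R) (u umid : 'M[R]_M) :
  (0 < M)%N -> L != 0 -> tau * sigma != 0 ->
  gdot L umid (const_mx 1) = gdot L u (const_mx 1) ->
  gdot L (etd_pred L epsilon kappa sigma theta theta_c tau u umid)
    (const_mx 1) =
  gdot L u (const_mx 1).
Proof.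
move=> M_gt0 L0 a0 mass_mid.
rewrite /etd_pred gdotDl gdotZl gdotDl gdotBl !gdot_opfun_stabop1.
by rewrite !gdot_nonlin1 // mass_mid -[RHS]mul1r -(phi0D a0); ring.
Qed.

Theorem lemma3p2 (R : realType) (M : nat)
    (L epsilon kappa sigma theta theta_c delta : R) (u0 : 'M[R]_M)
    (M_gt0 : (0 < M)%N) (L_gt0 : 0 < L)
    (epsilon_gt0 : 0 < epsilon) (kappa_gt0 : 0 < kappa) (sigma_gt0 : 0 < sigma)
    (theta_gt0 : 0 < theta) (theta_lt : theta < theta_c)
    (delta_gt0 : 0 < delta) (delta_lt1 : delta < 1)
    (u0_bnd : forall i j, -1 < u0 i j < 1) :
  forall tau : R, 0 < tau ->
  forall u : nat -> 'M[R]_M,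
    petdrk2 L epsilon kappa sigma theta theta_c delta tau u0 u ->
    forall n : nat,
      gdot L (u n.+1) (const_mx 1) = gdot L (u n) (const_mx 1).
Proof.
move=> tau tau_gt0 u [_ step] n.
have L0 : L != 0 by rewrite gt_eqF.
have a0 : tau * sigma != 0 by rewrite gt_eqF ?mulr_gt0.
(* Admissibility in each projection carries over the mass of its prediction: [mass_mid] for the
   midpoint, the immediate rewrite for [u n.+1]. *)
have [umid [[[_ mass_mid] _] [[_ ->] _]]] := step n.
by apply: gdot_etd_pred1 => //; rewrite mass_mid gdot_etd_mid1.
Qed.
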